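(* Let $Q(\lambda,\mu)=\lambda^2A_{20}+\lambda\mu A_{11}+\mu^2A_{02}+\lambda A_{10}+\mu A_{01}+A_{00}$ be a quadratic two-parameter matrix polynomial with coefficient matrices $A_{ij}\in\mathbb{C}^{n\times n}$, let $0\neq\alpha\in\mathbb{C}$ and $e_1=[1\ 0\ 0]^T$. Suppose $L(\lambda,\mu)=\lambda\widehat{A}_1+\mu\widehat{A}_2+\widehat{A}_3\in\mathbb{L}(Q(\lambda,\mu))$ with respect to the ansatz vector $v=\alpha e_1\in\mathbb{C}^3$, where $$\widehat{A}_1=\begin{bmatrix}\alpha e_1\otimes A_{20} & -Y_1+\alpha e_1\otimes A_{11} & -Z_1+\alpha e_1\otimes A_{10}\end{bmatrix},$$ $$\widehat{A}_2=\begin{bmatrix}Y_1 & \alpha e_1\otimes A_{02} & -Z_2+\alpha e_1\otimes A_{01}\end{bmatrix},$$ $$\widehat{A}_3=\begin{bmatrix}Z_1 & Z_2 & \alpha e_1\otimes A_{00}\end{bmatrix},$$ with $$Y_1=\begin{bmatrix}Y_{11}\\0\\0\end{bmatrix},\quad Z_1=\begin{bmatrix}Z_{11}\\Z_{21}\\Z_{31}\end{bmatrix},\quad Z_2=\begin{bmatrix}Z_{12}\\Z_{22}\\Z_{32}\end{bmatrix}\in\mathbb{C}^{3n\times n}$$ partitioned into $n\times n$ blocks, and $$\det\begin{bmatrix}Z_{21}&Z_{22}\\Z_{31}&Z_{32}\end{bmatrix}\neq 0.$$ Then $L(\lambda,\mu)$ is a linearization of $Q(\lambda,\mu)$.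
   Context: Here $\otimes$ is the Kronecker product, $I_k$ is the $k\times k$ identity matrix, and $\Lambda=\begin{bmatrix}\lambda\\ \mu\\ 1\end{bmatrix}$. The space $\mathbb{L}(Q(\lambda,\mu))$ consists of all $L(\lambda,\mu)=\lambda\widehat{A}_1+\mu\widehat{A}_2+\widehat{A}_3$ with $\widehat{A}_i\in\mathbb{C}^{3n\times 3n}$ such that $L(\lambda,\mu)\cdot(\Lambda\otimes I_n)=v\otimes Q(\lambda,\mu)$ (identically in $\lambda,\mu$) for some $v\in\mathbb{C}^3$; such a $v$ is called an ansatz vector associated with $L(\lambda,\mu)$. An $ln\times ln$ linear matrix polynomial $L(\lambda,\mu)=\lambda\widehat{A}_1+\mu\widehat{A}_2+\widehat{A}_3$ is a linearization of an $n\times n$ matrix polynomial $Q(\lambda,\mu)$ if there exist matrix polynomials $P(\lambda,\mu)$ and $R(\lambda,\mu)$ (of size $ln\times ln$), each with determinant a non-zero constant independent of $\lambda$ and $\mu$, such that $$\begin{bmatrix}Q(\lambda,\mu)&0\\0&I_{(l-1)n}\end{bmatrix}=P(\lambda,\mu)L(\lambda,\mu)R(\lambda,\mu).$$ Here $l=3$. *)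

(* Defs.v *)
From mathcomp Require Import all_boot all_order all_algebra.
From mathcomp Require Export mxtens mpoly complex reals.

Set Implicit Arguments.
Unset Strict Implicit.
Unset Printing Implicit Defensive.

Import GRing.Theory.
Local Open Scope ring_scope.

(* A two-parameter m x p matrix polynomial over F is a matrix over the
   polynomial ring {mpoly F[2]}, so that an identity holding "identically in
   lambda and mu" is an equality of such matrices. *)
Notation mxpoly2 F m p := 'M[{mpoly F[2]}]_(m, p).

Definition lam {F : fieldType} : {mpoly F[2]} := 'X_(@ord0 1).
Definition mu {F : fieldType} : {mpoly F[2]} := 'X_(@ord_max 1).

Section TwoParameter.
Variable F : fieldType.

Definition cmx (m p : nat) (A : 'M[F]_(m, p)) : mxpoly2 F m p :=
  map_mx (@mpolyC 2 F) A.

Definition linear2 (m : nat) (A1 A2 A3 : 'M[F]_m) : mxpoly2 F m m :=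
  lam *: cmx A1 + mu *: cmx A2 + cmx A3.

Definition quadratic2 (n : nat) (A20 A11 A02 A10 A01 A00 : 'M[F]_n) :
    mxpoly2 F n n :=
  lam ^+ 2 *: cmx A20 + (lam * mu) *: cmx A11 + mu ^+ 2 *: cmx A02
  + lam *: cmx A10 + mu *: cmx A01 + cmx A00.

Definition is_linear2 (m : nat) (L : mxpoly2 F m m) : Prop :=
  exists A1 A2 A3 : 'M[F]_m, L = linear2 A1 A2 A3.

Definition Lambda : mxpoly2 F 3 1 :=
  \col_(i < 3) nth 0 [:: lam; mu; 1] i.

(* L belongs to the space L(Q) with ansatz vector v. *)
Definition in_ansatz_space (n : nat) (Q : mxpoly2 F n n)
    (L : mxpoly2 F (3 * n) (3 * n)) (v : 'cV[F]_3) : Prop :=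
  is_linear2 L /\ L *m (Lambda *t (1%:M : mxpoly2 F n n)) = cmx v *t Q.

Definition unimodular2 (m : nat) (P : mxpoly2 F m m) : Prop :=
  exists2 c : F, c != 0 & \det P = c%:MP.

(* The block size l of the definition is k.+1 here, which excludes l = 0;
   k.+1 * n is convertible to n + k * n, the size of the block matrix. *)
Definition is_linearization (k n : nat) (Q : mxpoly2 F n n)
    (L : mxpoly2 F (k.+1 * n) (k.+1 * n)) : Prop :=
  is_linear2 L /\
  exists P R : mxpoly2 F (k.+1 * n) (k.+1 * n),
    [/\ unimodular2 P, unimodular2 R
      & block_mx Q 0 0 (1%:M : mxpoly2 F (k * n) (k * n)) = P *m L *m R].

End TwoParameter.

Arguments is_linearization {F k n} Q L.

Fact three_blocks (n : nat) : (n + (n + n) = 3 * n)%N.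
Proof. by rewrite !mulSn mul0n addn0. Qed.

Definition row3 (F : fieldType) (m n : nat) (A B C : 'M[F]_(m, n)) :
    'M[F]_(m, 3 * n) :=
  castmx (erefl m, three_blocks n) (row_mx A (row_mx B C)).

Definition col3 (F : fieldType) (m n : nat) (A B C : 'M[F]_(m, n)) :
    'M[F]_(3 * m, n) :=
  castmx (three_blocks m, erefl n) (col_mx A (col_mx B C)).

(* The Kronecker product v (x) A with the column count 1 * n cast to n. *)
Definition kronv (F : fieldType) (m n : nat) (v : 'cV[F]_m) (A : 'M[F]_n) :
    'M[F]_(m * n, n) :=
  castmx (erefl (m * n)%N, mul1n n) (v *t A).

Definition e1 {F : fieldType} : 'cV[F]_3 := delta_mx 0 0.

(* Main.v *)
(* The block column Lambda (x) I_n extends to the unimodular matrix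
     C = [lam I, I, 0; mu I, 0, I; I, 0, 0].
   The first block column of L C is L (Lambda (x) I_n) = alpha e_1 (x) Q, and
   its other two are the first two of L, whose two lower block rows form the
   constant matrix W = [Z21, Z22; Z31, Z32] because Y1 vanishes there.  So
   L C = [alpha Q, X; 0, W], and since alpha and W are invertible constants,
   unimodular row operations reduce it to diag(Q, I_2n). *)
Require Import Defs.
From mathcomp Require Import all_boot all_order all_algebra.
From mathcomp Require Import ring.
Import GRing.Theory.
Local Open Scope ring_scope.

(** The units of a polynomial ring over a field are the nonzero constants, so exhibiting an inverse
    matrix replaces computing a determinant. *)
Lemma unitmx_unimodular2 (F : fieldType) (m : nat) (P : mxpoly2 F m m) :
  P \in unitmx -> unimodular2 P.
Proof.
rewrite unitmxE => /andP[/eqP detP u]; exists (\det P)@_0 => //.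
by rewrite -unitfE.
Qed.

Lemma unimodular2_castmx (F : fieldType) (m m' : nat) (e : m = m')
    (P : mxpoly2 F m m) :
  unimodular2 P -> unimodular2 (castmx (e, e) P).
Proof. by case: m' / e. Qed.

Lemma linear2_castmx (F : fieldType) (m m' : nat) (e : m = m')
    (A1 A2 A3 : 'M[F]_m) :
  linear2 (castmx (e, e) A1) (castmx (e, e) A2) (castmx (e, e) A3) =
  castmx (e, e) (linear2 A1 A2 A3).
Proof. by case: m' / e. Qed.

Lemma castmx_oppD (V : zmodType) (m n m' n' : nat)
    (e : (m = m') * (n = n')) (A B : 'M[V]_(m, n)) :
  castmx e (- A + B) = - castmx e A + castmx e B.
Proof. by case: e => em en; case: m' / em; case: n' / en. Qed.

Lemma castmx_mulmx3 (R : pzRingType) (m m' : nat) (e : m = m')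
    (A B C : 'M[R]_m) :
  castmx (e, e) (A *m B *m C) =
  castmx (e, e) A *m castmx (e, e) B *m castmx (e, e) C.
Proof. by case: m' / e. Qed.

(** The identity block arises with size n + n but is wanted with size 2 * n. Cancelling [m] in [e]
    leaves an equation between these two sizes. *)
Lemma castmx_block_diag1 (R : pzRingType) (m n n' : nat)
    (e : (m + n = m + n')%N) (Q : 'M[R]_m) :
  castmx (e, e) (block_mx Q 0 0 1%:M) = block_mx Q 0 0 1%:M.
Proof. by have en := addnI e; case: n' / en in e *; rewrite castmx_id. Qed.

Lemma row3_castmx (F : fieldType) (m n m' : nat) (e : m = m')
    (A B C : 'M[F]_(m, n)) :
  row3 (castmx (e, erefl n) A) (castmx (e, erefl n) B)
       (castmx (e, erefl n) C) =
  castmx (e, three_blocks n) (row_mx A (row_mx B C)).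
Proof. by case: m' / e. Qed.

Lemma kronv_e1 (F : fieldType) (n : nat) (alpha : F) (A : 'M[F]_n) :
  kronv (alpha *: e1) A = col3 (alpha *: A) 0 0.
Proof.
rewrite /kronv /col3 col_mx0; apply/matrixP => i j.
have [h ->] : exists h, i = cast_ord (three_blocks n) h.
  by exists (cast_ord (esym (three_blocks n)) i); rewrite cast_ordKV.
rewrite !castmxE !mxE; set u := mxtens_unindex _; set w := mxtens_unindex _.
rewrite [w.1]ord1 andbT cast_ordK.
have -> : w.2 = j by apply: val_inj; rewrite /= modn_small.
have [] : u.1 = (h %/ n)%N :> nat /\ u.2 = (h %% n)%N :> nat by [].
case: {w}u => [u1 u2] /= hu1 hu2; rewrite -val_eqE /= hu1 cast_ord_id.
case: (split_ordP h) => k hk.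
  have -> : u2 = k by apply: val_inj; rewrite /= hu2 hk /= modn_small.
  by rewrite mxE hk /= divn_small // mulr1.
(* The index [j] witnesses 0 < n, so below the top block (n + k) %/ n is a successor, and the entry
   of [e1] there is 0. *)
rewrite mxE hk /= divnDl ?dvdnn // divnn (leq_ltn_trans (leq0n j) (ltn_ord j)).
by rewrite mulr0 mul0r.
Qed.

Definition lambda_completion (F : fieldType) (n : nat) :
    mxpoly2 F (n + (n + n)) (n + (n + n)) :=
  block_mx lam%:M (row_mx 1%:M 0) (col_mx mu%:M 1%:M) (block_mx 0 1%:M 0 0).

Lemma mulmx_lambda_completion (F : fieldType) (m n : nat)
    (A B C : mxpoly2 F m n) :
  row_mx A (row_mx B C) *m lambda_completion F n =
  row_mx (lam *: A + mu *: B + C) (row_mx A B).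
Proof.
rewrite mul_row_block mul_row_col mul_row_block mul_mx_row.
rewrite !mul_mx_scalar !(mulmx0, mulmx1) !addr0 add_row_mx.
by rewrite !scale1r addr0 add0r addrA.
Qed.

Lemma lambda_completion_unimodular2 (F : fieldType) (n : nat) :
  unimodular2 (lambda_completion F n).
Proof.
(* The matrix C sends (x, y, z) to (lam x + y, mu x + z, x), so its inverse sends (a, b, c) to (c, a
   - lam c, b - mu c). *)
apply/unitmx_unimodular2/(proj1 (mulmx1_unit (B := block_mx
  0 (row_mx 0 1%:M) (col_mx 1%:M 0) (block_mx 0 (- lam%:M) 1%:M (- mu%:M))) _)).
rewrite mulmx_block mul_row_block mul_block_col mulmx_block mul_col_row.
rewrite mul_mx_row mul_row_col mul_col_mx.
rewrite !(mulmx0, mul0mx, mulmx1, mul1mx, add0r, addr0).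
rewrite add_row_mx add_block_mx !(addr0, add0r, subrr).
by rewrite !col_mx0 row_mx0 addr0 -!scalar_mx_block.
Qed.

(** The matrix [alpha Q, X; 0, W] factors as [alpha I, X; 0, W] diag(Q, I). The left factor has
    invertible constant diagonal blocks, whatever the polynomial block X, and [P] is its inverse. *)
Lemma block_triangular_reduction (F : fieldType) (m n : nat) (alpha : F)
    (Q : mxpoly2 F m m) (X : mxpoly2 F m n) (W : 'M[F]_n) :
  alpha != 0 -> W \in unitmx ->
  exists2 P : mxpoly2 F (m + n) (m + n), unimodular2 P &
    P *m block_mx (alpha%:MP *: Q) X 0 (cmx W) = block_mx Q 0 0 1%:M.
Proof.
move=> alpha0 uW.
have WV : cmx (invmx W) *m cmx W = 1%:M by rewrite -map_mxM mulVmx // map_mx1.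
have aV : (alpha^-1)%:MP * alpha%:MP = 1 :> {mpoly F[2]}.
  by rewrite -mpolyCM mulVf.
exists (block_mx (alpha^-1)%:MP%:M (- (alpha^-1)%:MP *: X *m cmx (invmx W))
          0 (cmx (invmx W))).
  apply: unitmx_unimodular2; rewrite unitmxE det_ublock det_scalar unitrM.
  rewrite -unitmxE; have [-> _] := mulmx1_unit WV.
  by rewrite andbT unitrX //; apply/unitrPr; exists alpha%:MP.
rewrite mulmx_block !(mulmx0, mul0mx, add0r, addr0) -mulmxA WV mulmx1.
by rewrite !mul_scalar_mx scalerA aV scale1r scaleNr subrr.
Qed.

Lemma lambda_combination_col_mx (R : pzRingType) (m1 m2 n : nat) (l m : R)
    (A B C : 'M[R]_(m1, n)) (A' B' C' : 'M[R]_(m2, n)) :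
  l *: col_mx A A' + m *: col_mx B B' + col_mx C C' =
  col_mx (l *: A + m *: B + C) (l *: A' + m *: B' + C').
Proof. by rewrite !scale_col_mx !add_col_mx. Qed.

(** The free blocks occur twice with opposite signs and cancel: [Y] at l m, [Z1] at l and [Z2] at m.
    What survives is the top block row of the ansatz identity. *)
Lemma lambda_combination_telescope (R : comPzRingType) (p n : nat) (l m a : R)
    (A20 A11 A02 A10 A01 A00 Y Z1 Z2 : 'M[R]_(p, n)) :
  l *: (l *: (a *: A20) + m *: Y + Z1) +
  m *: (l *: (- Y + a *: A11) + m *: (a *: A02) + Z2) +
  (l *: (- Z1 + a *: A10) + m *: (- Z2 + a *: A01) + a *: A00) =
  a *: (l ^+ 2 *: A20 + (l * m) *: A11 + m ^+ 2 *: A02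
        + l *: A10 + m *: A01 + A00).
Proof. apply/matrixP => i j; rewrite !mxE; ring. Qed.

Lemma ansatz_pencil_completion (F : fieldType) (n : nat)
    (A20 A11 A02 A10 A01 A00 : 'M[F]_n) (alpha : F)
    (Y11 Z11 Z21 Z31 Z12 Z22 Z32 : 'M[F]_n)
    (k := fun A => col_mx (alpha *: A) (0 : 'M[F]_(n + n, n)))
    (Y1 := col_mx Y11 (0 : 'M[F]_(n + n, n)))
    (Z1 := col_mx Z11 (col_mx Z21 Z31)) (Z2 := col_mx Z12 (col_mx Z22 Z32)) :
  linear2 (row_mx (k A20) (row_mx (- Y1 + k A11) (- Z1 + k A10)))
          (row_mx Y1 (row_mx (k A02) (- Z2 + k A01)))
          (row_mx Z1 (row_mx Z2 (k A00))) *m lambda_completion F n =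
  block_mx (alpha%:MP *: quadratic2 A20 A11 A02 A10 A01 A00)
    (row_mx (lam *: cmx (alpha *: A20) + mu *: cmx Y11 + cmx Z11)
       (lam *: cmx (- Y11 + alpha *: A11) + mu *: cmx (alpha *: A02) + cmx Z12))
    0 (cmx (block_mx Z21 Z22 Z31 Z32)).
Proof.
rewrite /linear2 /cmx !map_row_mx !scale_row_mx !add_row_mx.
rewrite /k /Y1 /Z1 /Z2 !opp_col_mx !add_col_mx !map_col_mx.
(* Rewriting with [lambda_combination_col_mx] instead would let unification
   unfold [map_mx] against [col_mx], which takes minutes. *)
etransitivity.
  apply: (congr1 (mulmx^~ _)); apply: congr2; last apply: congr2;
    exact: lambda_combination_col_mx.
rewrite !(addr0, oppr0) !map_mx0 !scaler0 !(add0r, addr0).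
rewrite mulmx_lambda_completion block_mxEh lambda_combination_col_mx.
congr row_mx; last first.
  rewrite !map_row_mx -block_mxEh block_mxEv; congr col_mx.
  by rewrite -block_mxEh block_mxEv.
congr col_mx; last first.
  (* Below the top block only the lower parts Z1', Z2' of [Z1], [Z2] remain, and the first column is
     lam Z1' + mu Z2' - lam Z1' - mu Z2' = 0. *)
  rewrite -!opp_col_mx !map_mxN !map_col_mx !scalerN.
  by rewrite -opprD subrr.
rewrite /quadratic2 /cmx !(map_mxD, map_mxN, map_mxZ).
exact: lambda_combination_telescope.
Qed.

Lemma linearization_of_ansatz (F : fieldType) (n : nat)
  (A20 A11 A02 A10 A01 A00 : 'M[F]_n) (alpha : F)
  (Y11 Z11 Z21 Z31 Z12 Z22 Z32 : 'M[F]_n) :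
  alpha != 0 -> \det (block_mx Z21 Z22 Z31 Z32) != 0 ->
  let Y1 := col3 Y11 0 0 in
  let Z1 := col3 Z11 Z21 Z31 in
  let Z2 := col3 Z12 Z22 Z32 in
  is_linearization (k := 2) (quadratic2 A20 A11 A02 A10 A01 A00)
    (linear2
       (row3 (kronv (alpha *: e1) A20) (- Y1 + kronv (alpha *: e1) A11)
             (- Z1 + kronv (alpha *: e1) A10))
       (row3 Y1 (kronv (alpha *: e1) A02) (- Z2 + kronv (alpha *: e1) A01))
       (row3 Z1 Z2 (kronv (alpha *: e1) A00))).
Proof.
move=> alpha0 detW Y1 Z1 Z2; split; first by do 3!eexists.
have uW : block_mx Z21 Z22 Z31 Z32 \in unitmx by rewrite unitmxE unitfE.
have LR := ansatz_pencil_completion F n A20 A11 A02 A10 A01 A00 alpha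
  Y11 Z11 Z21 Z31 Z12 Z22 Z32; cbv zeta in LR.
set X := (X in block_mx _ X _ _) in LR.
(* All casts are moved outwards into a single one of the whole pencil, from size n + (n + n) to 3 *
   n, so that the uncast identity [LR] applies. *)
rewrite !kronv_e1 /Y1 /Z1 /Z2 /col3 !col_mx0 -!castmx_oppD !row3_castmx.
rewrite linear2_castmx.
pose e := three_blocks n.
have [P uP defP] :=
  block_triangular_reduction F n (n + n) alpha
  (quadratic2 A20 A11 A02 A10 A01 A00) X _ alpha0 uW.
exists (castmx (e, e) P), (castmx (e, e) (lambda_completion F n)); split.
- exact: unimodular2_castmx.
- exact/unimodular2_castmx/lambda_completion_unimodular2.
rewrite -castmx_mulmx3 -mulmxA LR defP.
exact/esym/castmx_block_diag1.
Qed.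

Theorem theorem2p9 (R : realType) (n : nat)
  (A20 A11 A02 A10 A01 A00 : 'M[R[i]]_n) (alpha : R[i])
  (Y11 Z11 Z21 Z31 Z12 Z22 Z32 : 'M[R[i]]_n)
  (Y1 Z1 Z2 : 'M[R[i]]_(3 * n, n)) (A1 A2 A3 : 'M[R[i]]_(3 * n))
  (halpha : alpha != 0)
  (hY1 : Y1 = col3 Y11 0 0)
  (hZ1 : Z1 = col3 Z11 Z21 Z31)
  (hZ2 : Z2 = col3 Z12 Z22 Z32)
  (hA1 : A1 = row3 (kronv (alpha *: e1) A20)
                   (- Y1 + kronv (alpha *: e1) A11)
                   (- Z1 + kronv (alpha *: e1) A10))
  (hA2 : A2 = row3 Y1
                   (kronv (alpha *: e1) A02)
                   (- Z2 + kronv (alpha *: e1) A01))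
  (hA3 : A3 = row3 Z1 Z2 (kronv (alpha *: e1) A00))
  (hL : in_ansatz_space (quadratic2 A20 A11 A02 A10 A01 A00)
                        (linear2 A1 A2 A3) (alpha *: e1))
  (hdet : \det (block_mx Z21 Z22 Z31 Z32) != 0) :
  is_linearization (k := 2) (quadratic2 A20 A11 A02 A10 A01 A00)
                   (linear2 A1 A2 A3).
Proof. by subst; apply: linearization_of_ansatz. Qed.
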